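(* We have $$R(k,\ell) \le e^{-\ell/400 + o(k)} \binom{k + \ell}{\ell}$$ for all $k,\ell \in \mathbb{N}$ with $\ell \le k$.
   Context: The Ramsey number $R(k,\ell)$ is the minimum $n \in \mathbb{N}$ such that every red-blue colouring of the edges of the complete graph $K_n$ contains either a red copy of $K_k$ or a blue copy of $K_\ell$. The term $o(k)$ denotes a function of $k$ only (uniform over all admissible $\ell$) which, divided by $k$, tends to $0$ as $k \to \infty$. *)

(* Defs.v *)
From mathcomp Require Import all_boot.

Set Implicit Arguments.
Unset Strict Implicit.
Unset Printing Implicit Defensive.

Definition edge (n : nat) := {e : {set 'I_n} | #|e| == 2}.

(* true is red, false is blue. *)
Definition colouring (n : nat) := {ffun edge n -> bool}.

Definition has_mono_clique (n : nat) (c : colouring n) (col : bool) (k : nat) :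
    bool :=
  [exists S : {set 'I_n}, (#|S| == k) &&
     [forall e : edge n, (val e \subset S) ==> (c e == col)]].

Definition arrows (n k l : nat) : bool :=
  [forall c : colouring n,
     has_mono_clique c true k || has_mono_clique c false l].

(* The two lemmas below only show that the minimum defining R(k, l) exists;
   the bound 2 ^ (k + l) plays no other role. *)
Lemma ramsey_rel (T : finType) (r : rel T) (k l : nat) (A : {set T}) :
  symmetric r -> 2 ^ (k + l) <= #|A| ->
  (exists2 S : {set T}, S \subset A &
     #|S| = k /\ {in S &, forall x y, x != y -> r x y}) \/
  (exists2 S : {set T}, S \subset A &
     #|S| = l /\ {in S &, forall x y, x != y -> ~~ r x y}).
Proof.
move=> rC; have [m] := ubnP (k + l); elim: m k l A => // m IH [|k] l A klm cA.
  by left; exists set0; rewrite ?sub0set ?cards0 //; split=> // x y; rewrite inE.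
case: l klm cA => [|l] klm cA.
  by right; exists set0; rewrite ?sub0set ?cards0 //; split=> // x y; rewrite inE.
have /card_gt0P[x xA]: 0 < #|A| by apply: leq_trans cA; rewrite expn_gt0.
pose N := [set y in A :\ x | r x y]; pose M := [set y in A :\ x | ~~ r x y].
have NA : N \subset A by apply/subsetP=> y; rewrite !inE => /andP[/andP[]].
have MA : M \subset A by apply/subsetP=> y; rewrite !inE => /andP[/andP[]].
have cNM : #|A| = (#|N| + #|M|).+1.
  rewrite (cardsD1 x) xA add1n; congr _.+1.
  rewrite -(cardsID [set y | r x y]); congr (_ + _); apply: eq_card => y;
    by rewrite !inE // andbC.
have ext (b : bool) (S : {set T}) j : S \subset A :\ x ->
    (forall y, y \in S -> r x y = b) -> #|S| = j ->
    {in S &, forall y z, y != z -> r y z = b} ->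
    x |: S \subset A /\ #|x |: S| = j.+1 /\
    {in x |: S &, forall y z, y != z -> r y z = b}.
  move=> SA xS cS hS; have xNS : x \notin S.
    by apply/negP => /(subsetP SA); rewrite !inE eqxx.
  split.
    by rewrite subUset sub1set xA (subset_trans SA) // subD1set.
  split; first by rewrite cardsU1 xNS cS.
  move=> y z /setU1P[->|yS] /setU1P[->|zS]; rewrite ?eqxx // => yz.
  - exact: xS.
  - by rewrite rC; exact: xS.
  - exact: hS.
have NAx : N \subset A :\ x by apply/subsetP=> y; rewrite inE => /andP[].
have MAx : M \subset A :\ x by apply/subsetP=> y; rewrite inE => /andP[].
have [hN|hN] := leqP (2 ^ (k + l.+1)) #|N|.
  have [|[S SN [cS hS]]|[S SN [cS hS]]] := IH k l.+1 N _ hN; first by [].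
    left; have [|y /(subsetP SN)|||SA [cSx hSx]] := ext true S k => //.
    - exact: subset_trans NAx.
    - by rewrite inE => /andP[].
    - by exists (x |: S).
  by right; exists S; rewrite ?(subset_trans SN).
have hM : 2 ^ (k.+1 + l) <= #|M|.
  rewrite addSnnS; move: cA hN; rewrite cNM addSn expnS mul2n -addnn => h1 h2.
  rewrite -(leq_add2l (2 ^ (k + l.+1))) (leq_trans h1) // -addSn.
  by rewrite leq_add2r.
have [|[S SM [cS hS]]|[S SM [cS hS]]] := IH k.+1 l M _ hM.
- by rewrite addSnnS.
- by left; exists S; rewrite ?(subset_trans SM).
right; have [|y /(subsetP SM)|||SA [cSx hSx]] := ext false S l => //.
- exact: subset_trans MAx.
- by rewrite inE => /andP[_ /negbTE].
- by move=> y z yS zS yz; apply/negbTE/hS.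
- by exists (x |: S) => //; split=> // y z yS zS yz; rewrite hSx.
Qed.

Lemma ramsey_exists (k l : nat) : exists n, arrows n k l.
Proof.
exists (2 ^ (k + l)); set n := 2 ^ (k + l); apply/forallP => c.
pose r (x y : 'I_n) := if insub [set x; y] is Some e then c e else true.
have rC : symmetric r by move=> x y; rewrite /r setUC.
have rE x y (e : edge n) : val e = [set x; y] -> r x y = c e.
  by move=> exy; rewrite /r -exy valK.
have clique col (S : {set 'I_n}) j : #|S| = j ->
    {in S &, forall x y, x != y -> r x y = col} -> has_mono_clique c col j.
  move=> cS hS; apply/existsP; exists S; rewrite cS eqxx.
  apply/forallP => e; apply/implyP => eS.
  have /cards2P[x [y [xy exy]]] := valP e.
  rewrite -(rE _ _ _ exy) hS //; apply: (subsetP eS); rewrite exy !inE eqxx //.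
  exact: orbT.
have [|[S _ [cS hS]]|[S _ [cS hS]]] := @ramsey_rel _ r k l [set: 'I_n] rC.
- by rewrite cardsT card_ord.
- by rewrite (clique true S) // => x y xS yS /hS ->.
- by rewrite orbC (clique false S) // => x y xS yS xy; apply/negbTE/hS.
Qed.

Definition ramsey (k l : nat) : nat := ex_minn (ramsey_exists k l).

(* Main.v *)
Require Import Defs.
From mathcomp Require Import all_boot all_order all_algebra.
From mathcomp Require Import boolp reals sequences exp zify ring lra.

(** Fix a colouring of [n] vertices without a red [k]-clique and without a blue
    [l]-clique, and put [s = l / (k + l)]. The theorem is true because of a
    shrinking process on two sets of vertices [X] and [Y], both equal to the whole
    vertex set at the start. For a constant [p], let [f(v)] be the amount by which
    the density of red edges from [v] to [Y] exceeds [p] (or 0), and let the weight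
    of [X] be the sum of [f(v) ^ (c + 1)] over [v] in [X]. There are three moves, each
    given by a vertex [u] of [X]:
    - blue: keep in [X] the blue neighbours of [u], and all of [Y];
    - red: keep in [X] and in [Y] the red neighbours of [u];
    - boost: keep in [X] the blue, and in [Y] the red neighbours of [u].
    The first and the last bring a blue clique in [X] one vertex closer, the second
    a red clique in the union of [X] and [Y].

    The blue move is made when some blue neighbourhood has at least the fraction
    [mu] of the weight. Otherwise one of the other two is cheap ([book_step]): by
    Cauchy-Schwarz ([correlation]) there is [u] with [f(u) > 0] such that replacing
    [Y] by its red neighbours of [u] does not decrease the average density, taken
    with weights [f ^ c], from [X] to [Y]. Hence either the red neighbours of [u] in
    [X] hardly lose density, or the blue ones, having less than the fraction [mu] of
    the weight, gain some; the large power in the weight turns a tiny gain in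
    density into a constant factor. This factor is chosen to make up for the loss
    of vertices of [Y], which shrinks at most by the factor [p] since [f(u) > 0].
    Thus [weight ^ 3 * |Y|] loses at most a factor [Z] in a red move and [mu ^ 3] in
    the other two. Once the weight is bounded, [Y] is so large that the classical
    binomial bound yields a clique inside it ([book_cliques]).

    Counting the moves gives, up to a constant,
    [n ^ 4 <= Z ^ (-k) * (mu ^ 3 * (1 - Z)) ^ (-l)], where [1 - Z] is the price of
    the last stage. The binomial bound amounts to
    [n ^ 4 <= (1 - s) ^ (-4 k) * s ^ (-4 l)], and it is the case [Z = (1 - s) ^ 4]
    that can be compared: then [mu = 1 - (1 - s) ^ (19 / 25)] is admissible and
    [mu ^ 3 * (1 - Z) >= expR (1 / 100) * s ^ 4] for all [s <= 1 / 2] ([book_gain]), a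
    gain of [expR (- l / 400)] for [n].

    The process needs the red densities to exceed [p], which is close to [1 - s].
    They do because the blue degrees are smaller than [R(k, l - 1)], which is at most
    about [s * n] by induction on [l] ([ramsey_le_expR]). *)

Set Implicit Arguments.
Unset Strict Implicit.
Unset Printing Implicit Defensive.
Import Order.TTheory GRing.Theory Num.Theory.

(** * Cliques in relations and Ramsey numbers *)

Section Cliques.
Variables (T : finType) (r : rel T).

Definition nbr (b : bool) (u : T) : {set T} := [set v | (v != u) && (r u v == b)].

Definition has_clique (b : bool) (k : nat) (A : {set T}) : Prop :=
  exists2 S : {set T}, S \subset A &
    #|S| = k /\ {in S &, forall x y, x != y -> r x y = b}.

Lemma has_clique0 b A : has_clique b 0 A.
Proof.
by exists set0; rewrite ?sub0set ?cards0 //; split=> // x y; rewrite inE.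
Qed.

Lemma has_clique_sub b k (A B : {set T}) :
  A \subset B -> has_clique b k A -> has_clique b k B.
Proof. by move=> AB [S SA hS]; exists S => //; exact: subset_trans AB. Qed.

Hypothesis rC : symmetric r.

Lemma has_clique_nbr b k u (A : {set T}) :
  u \in A -> has_clique b k (A :&: nbr b u) -> has_clique b k.+1 A.
Proof.
move=> uA [S /subsetP SA [cS hS]].
have SN y : y \in S -> y != u /\ r u y = b.
  by move=> /SA; rewrite !inE => /andP[_ /andP[? /eqP]].
have uS : u \notin S by apply/negP => /SN[]; rewrite eqxx.
exists (u |: S).
  by apply/subsetP => y /setU1P[->//|/SA]; rewrite inE => /andP[].
split; first by rewrite cardsU1 uS cS.
move=> x y /setU1P[->|xS] /setU1P[->|yS]; rewrite ?eqxx // => xy.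
- by case: (SN _ yS).
- by rewrite rC; case: (SN _ xS).
- exact: hS.
Qed.

Lemma card_nbr u (A : {set T}) :
  u \in A -> #|A| = (#|A :&: nbr true u| + #|A :&: nbr false u|).+1.
Proof.
move=> uA; rewrite (cardsD1 u) uA add1n; congr _.+1.
rewrite -(cardsID [set v | r u v]); congr (_ + _); apply: eq_card => v;
  by rewrite !inE; case: (v \in A); case: (v == u); case: (r u v).
Qed.

(** By Pascal's rule, around any vertex one of the two colours is frequent enough
    for the induction to go on inside its neighbourhood. *)
Lemma erdos_szekeres k l (A : {set T}) :
  'C(k + l, l) <= #|A| -> has_clique true k A \/ has_clique false l A.
Proof.
have [m] := ubnP (k + l); elim: m k l A => // m IH [|k] [|l] A klm cA;
  [left|left|right|]; try exact: has_clique0.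
have /card_gt0P[u uA] : 0 < #|A|.
  by apply: leq_trans cA; rewrite bin_gt0 leq_addl.
have pascal : 'C(k.+1 + l.+1, l.+1) = 'C(k + l.+1, l.+1) + 'C(k.+1 + l, l).
  by rewrite addSn binS addSnnS.
rewrite pascal (card_nbr uA) in cA.
have [hN|hN] := leqP 'C(k + l.+1, l.+1) #|A :&: nbr true u|.
  have [|//|h|h] := IH k l.+1 (A :&: nbr true u).
  - by move: klm; rewrite addSn.
  - by left; exact: has_clique_nbr h.
  - by right; apply: has_clique_sub h; exact: subsetIl.
have [||h|h] := IH k.+1 l (A :&: nbr false u).
- by move: klm; rewrite addnS.
- by lia.
- by left; apply: has_clique_sub h; exact: subsetIl.
- by right; exact: has_clique_nbr h.
Qed.

End Cliques.

(** Colourings of the two-element subsets are traded for symmetric relations,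
    in which neighbourhoods are easier to handle. This lemma and the next one
    are the two directions of the translation. *)
Lemma arrows_rel n k l :
  (forall r : rel 'I_n, symmetric r ->
     has_clique r true k setT \/ has_clique r false l setT) ->
  arrows n k l.
Proof.
move=> H; apply/forallP => c.
pose r (x y : 'I_n) := if insub [set x; y] is Some e then c e else true.
have rC : symmetric r by move=> x y; rewrite /r setUC.
have clique b j : has_clique r b j setT -> has_mono_clique c b j.
  move=> [S _ [cS hS]]; apply/existsP; exists S; rewrite cS eqxx.
  apply/forallP => e; apply/implyP => eS.
  have /cards2P[x [y [xy exy]]] := valP e.
  have <- : r x y = c e by rewrite /r -exy valK.
  by rewrite hS //; apply: (subsetP eS); rewrite exy !inE eqxx ?orbT.
by apply/orP; case: (H _ rC) => /clique; [left|right].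
Qed.

Lemma ramsey_clique (T : finType) (r : rel T) k l (A : {set T}) :
  symmetric r -> ramsey k l <= #|A| ->
  has_clique r true k A \/ has_clique r false l A.
Proof.
move=> rC; rewrite /ramsey; case: ex_minnP => n arr _ cA.
pose f (i : 'I_n) : T := enum_val (widen_ord cA i).
have f_inj : injective f.
  by move=> i j /enum_val_inj /(congr1 val) /= ij; exact: val_inj.
pose c : colouring n :=
  [ffun e : edge n =>
     [forall x in val e, forall y in val e, (x != y) ==> r (f x) (f y)]].
have cE (e : edge n) x y : x != y -> val e = [set x; y] -> c e = r (f x) (f y).
  move=> xy exy; rewrite ffunE; apply/idP/idP => [/forall_inP h|rxy].
    have /h/forall_inP/(_ y) : x \in val e by rewrite exy !inE eqxx.
    by rewrite exy !inE eqxx orbT xy => /(_ isT).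
  apply/forall_inP => a; rewrite exy !inE => aE.
  apply/forall_inP => b; rewrite !inE => bE; apply/implyP.
  by case/orP: aE => /eqP->; case/orP: bE => /eqP->; rewrite ?eqxx // rC.
have clique b j : has_mono_clique c b j -> has_clique r b j A.
  move=> /existsP[S /andP[/eqP cS /forallP hS]].
  exists (f @: S); first by apply/subsetP => _ /imsetP[i _ ->]; exact: enum_valP.
  split; first by rewrite card_imset.
  move=> _ _ /imsetP[x xS ->] /imsetP[y yS ->] fxy.
  have xy : x != y by apply: contraNneq fxy => ->.
  have h2 : #|[set x; y]| == 2 by rewrite cards2 xy.
  rewrite -(cE (Sub [set x; y] h2) x y) //.
  apply/eqP; apply: (implyP (hS _)).
  by apply/subsetP => z /set2P[]->.
by have /orP[/clique|/clique] := forallP arr c; [left|right].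
Qed.

Lemma ramsey_le_bin k l : ramsey k l <= 'C(k + l, l).
Proof.
rewrite /ramsey; case: ex_minnP => n _; apply; apply: arrows_rel => r rC.
by apply: erdos_szekeres; rewrite // cardsT card_ord.
Qed.

Lemma ramsey_colouring n k l : n < ramsey k l ->
  exists r : rel 'I_n, [/\ symmetric r, ~ has_clique r true k setT &
                           ~ has_clique r false l setT].
Proof.
rewrite /ramsey; case: ex_minnP => m _ hm nm; apply: contrapT => H.
suff /hm : arrows n k l by rewrite leqNgt nm.
apply: arrows_rel => r rC; have [|h] := pselect (has_clique r true k setT).
  by left.
by right; apply: contrapT => h'; apply: H; exists r.
Qed.

(** * Correlation of neighbourhoods *)

Local Open Scope ring_scope.

Section Correlation.
Variables (R : realFieldType) (T : finType).
Implicit Types (X Y : {set T}) (s : T -> R).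

Lemma sum_sqr_ge Y (F : T -> R) :
  (\sum_(y in Y) F y) ^+ 2 <= #|Y|%:R * \sum_(y in Y) F y ^+ 2.
Proof.
have [->|Y0] := eqVneq Y set0; first by rewrite !big_set0 cards0 expr0n mulr0.
have cY : 0 < #|Y|%:R :> R by rewrite ltr0n card_gt0.
set A := \sum_(y in Y) F y.
have : 0 <= \sum_(y in Y) (#|Y|%:R * F y - A) ^+ 2.
  by apply: sumr_ge0 => y _; exact: sqr_ge0.
have -> : \sum_(y in Y) (#|Y|%:R * F y - A) ^+ 2 =
    #|Y|%:R * (#|Y|%:R * \sum_(y in Y) F y ^+ 2 - A ^+ 2).
  transitivity (\sum_(y in Y) (#|Y|%:R ^+ 2 * F y ^+ 2 - (2 * #|Y|%:R * A) * F y
      + A ^+ 2)); first by apply: eq_bigr => y _; ring.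
  by rewrite big_split sumrB /= -!mulr_sumr -/A sumr_const -mulr_natl; ring.
by rewrite pmulr_rge0 // subr_ge0.
Qed.

(** Two vertices drawn from [X] independently with weights [s] have, on average,
    at least as many common neighbours in [Y] as the sizes of their separate
    neighbourhoods predict: counting from the side of [Y], this is Cauchy-Schwarz
    for the total weight of the neighbours of [y] in [X]. If each [u] fell short of the
    prediction, the average would too. *)
Lemma correlation (N : T -> {set T}) X Y s :
  {in X, forall v, 0 <= s v} -> 0 < \sum_(v in X) s v ->
  exists u, [/\ u \in X, 0 < s u &
    #|Y :&: N u|%:R * (\sum_(v in X) s v * #|Y :&: N v|%:R) <=
    #|Y|%:R * \sum_(v in X) s v * #|Y :&: N u :&: N v|%:R].
Proof.
move=> s0 sgt0; apply: contrapT => H.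
set A := \sum_(v in X) s v * #|Y :&: N v|%:R.
have AE : \sum_(y in Y) \sum_(v in X | y \in N v) s v = A.
  rewrite (exchange_big_dep (mem X)) /=; last by move=> y v _ /andP[].
  apply: eq_bigr => v vX.
  have E : (fun y => [&& y \in Y, v \in X & y \in N v]) =1 mem (Y :&: N v).
    by move=> y; rewrite /= inE vX.
  by rewrite (eq_bigl _ _ E) sumr_const mulr_natr.
have BE : \sum_(y in Y) (\sum_(v in X | y \in N v) s v) ^+ 2 =
    \sum_(u in X) s u * \sum_(v in X) s v * #|Y :&: N u :&: N v|%:R.
  transitivity (\sum_(y in Y) \sum_(u in X | y \in N u)
      \sum_(v in X | y \in N v) s u * s v).
    apply: eq_bigr => y _; rewrite expr2 mulr_suml.
    by apply: eq_bigr => u _; rewrite mulr_sumr.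
  rewrite (exchange_big_dep (mem X)) /=; last by move=> y v _ /andP[].
  apply: eq_bigr => u uX; rewrite (exchange_big_dep (mem X)) /=; last first.
    by move=> y v _ /andP[].
  rewrite mulr_sumr; apply: eq_bigr => v vX.
  have E : (fun y => [&& y \in Y, u \in X & y \in N u] &&
      ((v \in X) && (y \in N v))) =1 mem (Y :&: N u :&: N v).
    by move=> y; rewrite /= !inE uX vX; case: (y \in Y).
  rewrite (eq_bigl (mem (Y :&: N u :&: N v)) _ E).
  by rewrite sumr_const mulrA mulr_natr.
have := sum_sqr_ge Y (fun y => \sum_(v in X | y \in N v) s v).
rewrite AE BE leNgt => /negP; apply.
have [u0 u0X su0] : exists2 u, u \in X & 0 < s u.
  apply: contrapT => h; move: sgt0; rewrite lt_neqAle => /andP[/negP]; case.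
  rewrite eq_sym; apply/eqP/big1 => v vX; apply/eqP.
  by rewrite eq_le s0 // andbT leNgt; apply/negP => sv; apply: h; exists v.
have -> : A ^+ 2 = \sum_(u in X) s u * (#|Y :&: N u|%:R * A).
  by rewrite expr2 {1}/A mulr_suml; apply: eq_bigr => u _; rewrite mulrA.
rewrite mulr_sumr.
have le u : u \in X -> 0 < s u ->
    #|Y|%:R * (s u * \sum_(v in X) s v * #|Y :&: N u :&: N v|%:R) <
    s u * (#|Y :&: N u|%:R * A).
  move=> uX su; rewrite mulrCA ltr_pM2l // ltNge; apply/negP => h.
  by apply: H; exists u.
rewrite (bigD1 u0) //= [ltRHS](bigD1 u0) //=; apply: ltr_leD; first exact: le.
apply: ler_sum => u /andP[uX _]; have := s0 _ uX; rewrite le_eqVlt.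
by move=> /predU1P[<-|/(le _ uX)/ltW//]; rewrite !mul0r mulr0.
Qed.

(** The arithmetic-geometric mean inequality for [a] taken once and [b] taken
    [n] times, in the form without roots. *)
Lemma amgm_pow n (a b : R) : 0 <= a -> 0 <= b ->
  n.+1%:R * (b ^+ n * a) <= a ^+ n.+1 + n%:R * b ^+ n.+1.
Proof.
move=> a0 b0; elim: n => [|n IH]; first by rewrite expr0 !expr1; lra.
have h : 0 <= n.+1%:R * b ^+ n * (a - b) ^+ 2.
  by rewrite mulr_ge0 ?sqr_ge0 // mulr_ge0 ?exprn_ge0.
have {}IH := ler_wpM2l a0 IH.
rewrite -subr_ge0 in IH; rewrite -subr_ge0.
have -> : a ^+ n.+2 + n.+1%:R * b ^+ n.+2 - n.+2%:R * (b ^+ n.+1 * a) =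
   (a * (a ^+ n.+1 + n%:R * b ^+ n.+1) - a * (n.+1%:R * (b ^+ n * a)))
   + n.+1%:R * b ^+ n * (a - b) ^+ 2.
  by rewrite -!natr1 !exprS; ring.
exact: addr_ge0.
Qed.

End Correlation.

(** * The shrinking process *)

Section Weights.
Variables (R : realFieldType) (T : finType) (r : rel T).
Implicit Types (X Y A : {set T}) (p : R).

(** Truncating at 0 makes the vertices with too few red neighbours in [Y] weightless;
    a vertex of positive excess always leaves the fraction [p] of [Y]. *)
Definition excess p Y v : R :=
  Num.max 0 (#|Y :&: nbr r true v|%:R / #|Y|%:R - p).

(** A high power of the excess: increasing the density by a small factor is worth
    as much as keeping a constant factor more vertices. *)
Definition weight p c X Y : R := \sum_(v in X) excess p Y v ^+ c.+1.

Lemma excess_ge0 p Y v : 0 <= excess p Y v.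
Proof. by rewrite /excess le_max lexx. Qed.

Lemma excess_le1 p Y v : 0 <= p -> excess p Y v <= 1.
Proof.
move=> p0; rewrite /excess ge_max ler01 /= lerBlDr.
have : #|Y :&: nbr r true v|%:R / #|Y|%:R <= 1 :> R.
  have [->|Y0] := eqVneq Y set0; first by rewrite cards0 invr0 mulr0.
  rewrite ler_pdivrMr ?ltr0n ?card_gt0 // mul1r ler_nat.
  by rewrite subset_leq_card // subsetIl.
lra.
Qed.

Lemma weight_ge0 p c X Y : 0 <= weight p c X Y.
Proof. by apply: sumr_ge0 => v _; rewrite exprn_ge0 ?excess_ge0. Qed.

Lemma sum_nbr (F : T -> R) X u : u \in X ->
  \sum_(v in X) F v = F u + \sum_(v in X :&: nbr r true u) F v
                          + \sum_(v in X :&: nbr r false u) F v.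
Proof.
move=> uX; rewrite (bigD1 u) //= -addrA; congr (_ + _).
rewrite (bigID [pred v | r u v]) /=; congr (_ + _); apply: eq_bigl => v;
  by rewrite !inE; case: (v \in X); case: (v == u); case: (r u v).
Qed.

(** Young's inequality for the conjugate exponents [c.+1] and [c.+1 / c], the
    free parameter [s] being the ratio [g / f] at which it is sharp. *)
Lemma young_sum c A (f g : T -> R) (s : R) :
  (forall v, 0 <= f v) -> (forall v, 0 <= g v) -> 0 <= s ->
  c.+1%:R * (s ^+ c * \sum_(v in A) f v ^+ c * g v) <=
  \sum_(v in A) g v ^+ c.+1 + c%:R * (s ^+ c.+1 * \sum_(v in A) f v ^+ c.+1).
Proof.
move=> f0 g0 s0; rewrite !mulr_sumr -big_split /=; apply: ler_sum => v _.
have := amgm_pow c (g0 v) (mulr_ge0 s0 (f0 v)).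
by rewrite !exprMn -!mulrA.
Qed.

(** The correlation lemma for the weights [excess ^+ c]: it compares densities
    to [Y] with densities to the smaller set [Y :&: nbr r true u], and the first
    side is exactly the weight of [X]. *)
Lemma excess_growth p c X Y : (0 < c)%N -> 0 < p -> 0 < weight p c X Y ->
  exists u, [/\ u \in X, p * #|Y|%:R <= #|Y :&: nbr r true u|%:R &
    weight p c X Y <=
    \sum_(v in X) excess p Y v ^+ c * excess p (Y :&: nbr r true u) v].
Proof.
move=> c0 p0 w0; pose s v := excess p Y v ^+ c.
have s_ge0 v : 0 <= s v by rewrite exprn_ge0 ?excess_ge0.
have s_gt0 v : 0 < s v -> 0 < excess p Y v.
  rewrite /s => sv; rewrite lt_neqAle excess_ge0 andbT.
  by apply: contraTneq sv => <-; rewrite -leNgt expr0n gtn_eqF.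
have sE v : s v * (#|Y :&: nbr r true v|%:R / #|Y|%:R - p) = excess p Y v ^+ c.+1.
  rewrite exprSr /s /excess; case: leP => // _.
  by rewrite expr0n gtn_eqF // !mul0r.
have [||u [uX su cu]] := @correlation R T (nbr r true) X Y s.
- by move=> v _; exact: s_ge0.
- rewrite lt_neqAle sumr_ge0 // andbT; apply/negP => /eqP/esym h.
  move: w0; rewrite /weight big1 ?ltxx // => v vX.
  by rewrite exprSr -/(s v) (psumr_eq0P _ h) // mul0r.
have := s_gt0 _ su; rewrite /excess lt_max ltxx /= subr_gt0 => pu.
have cY : 0 < #|Y|%:R :> R.
  rewrite lt_neqAle ler0n andbT; apply/negP => /eqP h.
  by move: pu; rewrite -h invr0 mulr0 ltNge ltW.
have {}pu : p * #|Y|%:R < #|Y :&: nbr r true u|%:R by rewrite -ltr_pdivlMr.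
have cYu : 0 < #|Y :&: nbr r true u|%:R :> R.
  by apply: lt_trans pu; exact: mulr_gt0.
exists u; split => //; first exact: ltW.
have h : \sum_(v in X) s v * (#|Y :&: nbr r true v|%:R / #|Y|%:R) <=
    \sum_(v in X) s v * (#|Y :&: nbr r true u :&: nbr r true v|%:R /
                         #|Y :&: nbr r true u|%:R).
  under eq_bigr do rewrite mulrA.
  under [leRHS]eq_bigr do rewrite mulrA.
  by rewrite -!mulr_suml ler_pdivrMr // mulrAC ler_pdivlMr // mulrC
    [leRHS]mulrC.
apply: (@le_trans _ _ (\sum_(v in X) s v *
    (#|Y :&: nbr r true u :&: nbr r true v|%:R / #|Y :&: nbr r true u|%:R - p))).
  rewrite /weight; under eq_bigr do rewrite -sE mulrBr.
  under [leRHS]eq_bigr do rewrite mulrBr.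
  by rewrite !sumrB lerD2r.
apply: ler_sum => v _; apply: ler_wpM2l; first exact: s_ge0.
by rewrite /excess le_max lexx orbT.
Qed.

(** If neither alternative held, splitting the sum in [excess_growth] into the
    red and the blue neighbours of [u] and bounding the two parts by Young's
    inequality, with ratios [sR] and [sB], would give
    [W <= 1 + ((1 - mu) * sR + mu * sB) * W] for the weight [W] of [X]. The
    summand 1 is the contribution of [u] itself, and a weight larger than [K]
    outgrows it. The absence of a heavy blue neighbourhood is what allows the
    factor [mu] in front of the larger ratio [sB]. *)
Lemma book_step p mu sR sB K c X Y :
  (0 < c)%N -> 0 < p -> 0 <= mu <= 1 -> 0 < sR -> sR <= sB -> 0 < K ->
  (1 - mu) * sR + mu * sB <= 1 - K^-1 ->
  K < weight p c X Y ->
  (forall u, u \in X -> weight p c (X :&: nbr r false u) Y < mu * weight p c X Y) ->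
  exists u, [/\ u \in X, p * #|Y|%:R <= #|Y :&: nbr r true u|%:R &
    (1 - mu) * sR ^+ c.+1 * weight p c X Y <=
      weight p c (X :&: nbr r true u) (Y :&: nbr r true u) \/
    mu * sB ^+ c.+1 * weight p c X Y <=
      weight p c (X :&: nbr r false u) (Y :&: nbr r true u)].
Proof.
move=> c0 p0 /andP[mu0 mu1] sR0 sRB K0 hK Kw noblue.
have [u [uX pu]] := excess_growth c0 p0 (lt_trans K0 Kw).
set Yu := Y :&: nbr r true u => gr; exists u; split=> //.
apply: contrapT => /not_orP[/negP + /negP]; rewrite -!ltNge => red blue.
have sB0 := lt_le_trans sR0 sRB.
(* Young's inequality with a weight [G] that is too small after the move. *)
have fin (s t G F n : R) : 0 < s -> G < t * s ^+ c.+1 * weight p c X Y ->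
    c.+1%:R * (s ^+ c * F) <= G + c%:R * (s ^+ c.+1 * n) ->
    c.+1%:R * F <= s * (t * weight p c X Y + c%:R * n).
  move=> s0 h1 h2; rewrite -(ler_pM2l (exprn_gt0 c s0)).
  rewrite mulrCA; apply: (le_trans h2).
  apply: (@le_trans _ _ (t * s ^+ c.+1 * weight p c X Y + c%:R * (s ^+ c.+1 * n))).
    by rewrite lerD2r ltW.
  by rewrite exprS le_eqVlt; apply/orP; left; apply/eqP; ring.
have young s A : 0 < s -> c.+1%:R * (s ^+ c * \sum_(v in A)
      excess p Y v ^+ c * excess p Yu v) <=
    weight p c A Yu + c%:R * (s ^+ c.+1 * weight p c A Y).
  by move=> s0; apply: young_sum (ltW s0) => v; exact: excess_ge0.
have {}red := fin _ _ _ _ _ sR0 red (young _ _ sR0).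
have {}blue := fin _ _ _ _ _ sB0 blue (young _ _ sB0).
move: gr; rewrite (sum_nbr _ uX).
set FR := \sum_(v in X :&: nbr r true u) _ in red *.
set FB := \sum_(v in X :&: nbr r false u) _ in blue *.
have : excess p Y u ^+ c * excess p Yu u <= 1.
  by rewrite mulr_ile1 ?exprn_ge0 ?excess_ge0 // ?exprn_ile1 ?excess_ge0
    ?excess_le1 ?ltW.
set Fu := _ * _ => Fu1 gr.
have {}noblue := noblue u uX.
have : weight p c (X :&: nbr r true u) Y + weight p c (X :&: nbr r false u) Y
       <= weight p c X Y.
  rewrite [leRHS](sum_nbr _ uX) -addrA lerDr.
  by rewrite exprn_ge0 ?excess_ge0.
move: red blue noblue gr Kw.
set n := weight p c X Y; set nR := weight _ _ _ _; set nB := weight _ _ _ _.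
move=> red blue noblue gr Kw nRB.
have n0 : 0 < n by exact: lt_trans Kw.
(* The left side is largest when the blue neighbours have all the weight [mu * n]
   that they may have. *)
have mix : sR * nR + sB * nB <= ((1 - mu) * sR + mu * sB) * n.
  have h1 : 0 <= (sB - sR) * (mu * n - nB).
    by rewrite mulr_ge0 ?subr_ge0 ?(ltW noblue).
  have h2 : 0 <= sR * (n - (nR + nB)) by rewrite mulr_ge0 ?subr_ge0 ?(ltW sR0).
  by clear -h1 h2; lra.
set h := (1 - mu) * sR + mu * sB in hK mix.
have c1 : 0 < c.+1%:R :> R by rewrite ltr0n.
have cE : c.+1%:R = 1 + c%:R :> R by rewrite -natr1 addrC.
have cmix : c%:R * (sR * nR + sB * nB) <= c%:R * (h * n).
  by apply: ler_wpM2l.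
have : c.+1%:R * n <= c.+1%:R * (1 + h * n).
  apply: (@le_trans _ _ (c.+1%:R * (Fu + FR + FB))); first by rewrite ler_pM2l.
  have : c.+1%:R * Fu <= c.+1%:R by rewrite -[leRHS]mulr1 ler_pM2l.
  rewrite !mulrDr mulr1 cE in red blue *; rewrite /h in cmix *.
  clear -red blue cmix; lra.
rewrite ler_pM2l //.
have : h * n <= (1 - K^-1) * n by apply: ler_wpM2r => //; exact: ltW.
have : 1 < K^-1 * n by rewrite mulrC ltr_pdivlMr ?mul1r.
lra.
Qed.

End Weights.

Section Book.
Variables (R : realFieldType) (T : finType) (r : rel T).
Hypothesis rC : symmetric r.
Variables (p mu sR sB K Z D : R) (c w L : nat).
Hypotheses (c0 : (0 < c)%N) (p0 : 0 < p) (mu01 : 0 <= mu <= 1) (sR0 : 0 < sR).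
Hypotheses (sRB : sR <= sB) (K0 : 0 < K).
Hypothesis hK : (1 - mu) * sR + mu * sB <= 1 - K^-1.
Hypothesis Z0 : 0 < Z.
Hypothesis red_cost : Z <= ((1 - mu) * sR ^+ c.+1) ^+ w * p.
Hypothesis boost_cost : mu ^+ w <= (mu * sB ^+ c.+1) ^+ w * p.
Hypothesis D_ge : forall j, K ^+ w * 'C(j + L, L)%:R * Z ^+ j <= D.

(** A red move multiplies [weight ^+ w * #|Y|] by at least [Z], a boost or a blue
    move by at least [mu ^+ w], and each of them extends a clique by one vertex.
    When the weight has dropped to [K], the hypothesis says that [Y] alone is
    large enough for the binomial bound; the constant [D] has to cover every
    number [j] of red vertices that may then still be missing, while the blue
    clique is sought in [Y] from scratch, with its full size [L]. Nothing keeps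
    [X] and [Y] apart: both may be the whole vertex set at the start. *)
Lemma book_cliques k l (X Y : {set T}) :
  D <= weight r p c X Y ^+ w * #|Y|%:R * Z ^+ k * (mu ^+ w) ^+ l ->
  [\/ has_clique r true k (X :|: Y), has_clique r false l X
    | has_clique r false L Y].
Proof.
have [m] := ubnP (k + l)%N; elim: m k l X Y => // m IH.
move=> [|k] l X Y klm hD; first by apply: Or31; exact: has_clique0.
case: l klm hD => [|l] klm hD; first by apply: Or32; exact: has_clique0.
have /andP[mu0 mu1] := mu01.
have w0 := weight_ge0 r p c.
have [hw|hw] := leP (weight r p c X Y) K.
  suff /(erdos_szekeres rC)[h|h] : ('C(k.+1 + L, L) <= #|Y|)%N.
  - by apply: Or31; apply: has_clique_sub h; exact: subsetUr.
  - exact: Or33.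
  rewrite -(ler_nat R) -(ler_pM2r (exprn_gt0 k.+1 Z0)) -(ler_pM2l (exprn_gt0 w K0)).
  rewrite mulrA; apply: (le_trans (D_ge _)); apply: (le_trans hD).
  rewrite mulrA; apply: (@le_trans _ _ (weight r p c X Y ^+ w * #|Y|%:R * Z ^+ k.+1)).
    rewrite ler_piMr ?mulr_ge0 ?exprn_ge0 ?(ltW Z0) //.
    by rewrite exprn_ile1 ?exprn_ge0 ?exprn_ile1.
  rewrite ler_wpM2r ?exprn_ge0 ?(ltW Z0) // ler_wpM2r //.
  by rewrite lerXn2r ?nnegrE ?(ltW K0).
have [[u uX hu]|noblue] := pselect (exists2 u, u \in X &
    mu * weight r p c X Y <= weight r p c (X :&: nbr r false u) Y).
  have [||h|h|h] := IH k.+1 l (X :&: nbr r false u) Y.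
  - by move: klm; rewrite addnS.
  - apply: (le_trans hD).
    rewrite [(mu ^+ w) ^+ l.+1]exprS mulrA ler_wpM2r ?exprn_ge0 //.
    rewrite [leLHS]mulrC !mulrA -exprMn ler_wpM2r ?exprn_ge0 ?(ltW Z0) //.
    by rewrite ler_wpM2r // lerXn2r ?nnegrE ?mulr_ge0.
  - apply: Or31; apply: has_clique_sub h; apply: setSU; exact: subsetIl.
  - by apply: Or32; exact: (has_clique_nbr rC uX).
  - exact: Or33.
have [|u [uX pu hu]] := book_step c0 p0 mu01 sR0 sRB K0 hK hw.
  by move=> u uX; rewrite ltNge; apply/negP => h; apply: noblue; exists u.
(* In a red move as in a boost, [Y] keeps at least the fraction [p]. *)
have move_to (x : R) (X' : {set T}) : 0 <= x ->
    x * weight r p c X Y <= weight r p c X' (Y :&: nbr r true u) ->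
    x ^+ w * p * (weight r p c X Y ^+ w * #|Y|%:R) <=
    weight r p c X' (Y :&: nbr r true u) ^+ w * #|Y :&: nbr r true u|%:R.
  move=> x0 hx; rewrite mulrACA -exprMn; apply: ler_pM => //.
  - by rewrite exprn_ge0 ?mulr_ge0.
  - by rewrite mulr_ge0 ?(ltW p0).
  - by rewrite lerXn2r ?nnegrE ?mulr_ge0.
set P := weight r p c X Y ^+ w * #|Y|%:R in hD move_to.
have P0 : 0 <= P by rewrite mulr_ge0 ?exprn_ge0.
have sB0 := lt_le_trans sR0 sRB.
case: hu => hu.
  have [||h|h|h] := IH k l.+1 (X :&: nbr r true u) (Y :&: nbr r true u).
  - by move: klm; rewrite addSn.
  - apply: (le_trans hD); rewrite ler_wpM2r ?exprn_ge0 //.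
    rewrite exprS mulrA ler_wpM2r ?exprn_ge0 ?(ltW Z0) //.
    have x0 : 0 <= (1 - mu) * sR ^+ c.+1.
      by rewrite mulr_ge0 ?exprn_ge0 ?subr_ge0 // ltW.
    by apply: le_trans (move_to _ _ x0 hu); rewrite mulrC ler_wpM2r.
  - apply: Or31; apply: (has_clique_nbr rC (u := u)); first by rewrite inE uX.
    by rewrite setIUl.
  - by apply: Or32; apply: has_clique_sub h; exact: subsetIl.
  - by apply: Or33; apply: has_clique_sub h; exact: subsetIl.
have [||h|h|h] := IH k.+1 l (X :&: nbr r false u) (Y :&: nbr r true u).
- by move: klm; rewrite addnS.
- apply: (le_trans hD); rewrite [(mu ^+ w) ^+ l.+1]exprS mulrA.
  rewrite ler_wpM2r ?exprn_ge0 // mulrAC ler_wpM2r ?exprn_ge0 ?(ltW Z0) //.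
  have x0 : 0 <= mu * sB ^+ c.+1 by rewrite mulr_ge0 ?exprn_ge0 // ltW.
  by apply: le_trans (move_to _ _ x0 hu); rewrite mulrC ler_wpM2r.
- by apply: Or31; apply: has_clique_sub h; apply: setUSS; exact: subsetIl.
- by apply: Or32; exact: (has_clique_nbr rC uX).
- by apply: Or33; apply: has_clique_sub h; exact: subsetIl.
Qed.

End Book.

(** * Choice of the parameters *)

Section Exp.
Variable R : realType.
Implicit Types x t s : R.

(** The chord of the exponential over the interval between 0 and [x], that is,
    Bernoulli's inequality for the power [t] of [expR x]. *)
Lemma expR_convex t x : 0 <= t <= 1 -> expR (t * x) <= 1 - t + t * expR x.
Proof.
move=> /andP[t0 t1].
have tangent y : expR (t * x) * (1 + (y - t * x)) <= expR y.
  rewrite -ler_pdivlMl ?expR_gt0 // -expRN -expRD [- _ + y]addrC; exact: expR_ge1Dx.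
have h1 := ler_wpM2l t0 (tangent x).
have : 0 <= 1 - t by rewrite subr_ge0.
move=> /ler_wpM2l/(_ _ _ (tangent 0)); rewrite expR0.
move: (expR (t * x)) (expR x) h1 => a b; lra.
Qed.

Lemma expRN_le x : 0 <= x -> expR (- x) <= 1 - x + x ^+ 2.
Proof.
move=> x0; have h := expR_ge1Dx x; have e0 := expR_gt0 (- x).
have : expR (- x) * (1 + x) <= 1.
  by rewrite -[leRHS](expRxMexpNx_1 x) mulrC ler_wpM2r // ltW.
move: (expR (- x)) e0 => a a0 ha; have x1 : 0 < 1 + x by lra.
rewrite -(ler_pM2r x1); apply: (le_trans ha).
have -> : (1 - x + x ^+ 2) * (1 + x) = 1 + x ^+ 3 by ring.
by rewrite lerDl exprn_ge0.
Qed.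

Lemma expR_le x : 0 <= x <= 1 / 2 -> expR x <= 1 + x + 2 * x ^+ 2.
Proof.
move=> /andP[x0 x1]; have h := expR_ge1Dx (- x); have e0 := expR_gt0 x.
have : expR x * (1 - x) <= 1 by rewrite -[leRHS](expRxMexpNx_1 x) ler_wpM2l // ltW.
move: (expR x) e0 => a a0 ha; have x2 : 0 < 1 - x by lra.
rewrite -(ler_pM2r x2); apply: (le_trans ha).
have -> : (1 + x + 2 * x ^+ 2) * (1 - x) = 1 + x ^+ 2 * (1 - 2 * x) by ring.
by rewrite lerDl mulr_ge0 ?exprn_ge0 //; lra.
Qed.

(** Such a [b] is [2 ^ (- 19 / 25)], the value of [1 - mu] at [s = 1 / 2]. *)
Lemma half_pow_bounds (b : R) : 0 <= b -> b ^+ 25 = (1 / 2) ^+ 19 ->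
  59 / 100 <= b <= 5906 / 10000.
Proof.
move=> b0 bE; apply/andP.
split; rewrite -(@ler_pXn2r _ 25) ?nnegrE ?bE ?divr_ge0 ?ler0n //; lra.
Qed.

(** Dividing by [s ^+ 4] leaves [m ^+ 3 * (4 - 6 * s + 4 * s ^+ 2 - s ^+ 3)], where
    the second factor decreases in [s]; hence it suffices to know a lower bound
    [a] for [m] and an upper bound [b] for [s]. *)
Lemma cubic_bounds (m s a b e : R) :
  0 <= e -> 0 <= a -> 0 <= m * s -> 0 < s -> a <= m ->
  s <= b -> b <= 1 / 2 -> e <= a ^+ 3 * (4 - 6 * b + 4 * b ^+ 2 - b ^+ 3) ->
  e * s ^+ 4 <= (m * s) ^+ 3 * (1 - (1 - s) ^+ 4).
Proof.
move=> e0 a0 ms0 s0 am sb b2 he.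
have -> : (m * s) ^+ 3 * (1 - (1 - s) ^+ 4) =
   (m ^+ 3 * (4 - 6 * s + 4 * s ^+ 2 - s ^+ 3)) * s ^+ 4 by ring.
rewrite ler_wpM2r ?exprn_ge0 ?(ltW s0) //; apply: (le_trans he).
have q (b' : R) : 0 <= b' <= 1 / 2 -> 0 <= 4 - 6 * b' + 4 * b' ^+ 2 - b' ^+ 3.
  by move=> /andP[h1 h2]; nra.
apply: ler_pM; rewrite ?exprn_ge0 ?q //.
- by apply/andP; split; lra.
- by rewrite lerXn2r ?nnegrE // (le_trans a0).
rewrite -subr_ge0.
have -> : 4 - 6 * s + 4 * s ^+ 2 - s ^+ 3 - (4 - 6 * b + 4 * b ^+ 2 - b ^+ 3) =
  (b - s) * (6 - 4 * (b + s) + (b ^+ 2 + b * s + s ^+ 2)) by ring.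
rewrite mulr_ge0 ?subr_ge0 //.
have bs0 : 0 <= b * s by apply: mulr_ge0; lra.
by have := sqr_ge0 b; have := sqr_ge0 s; lra.
Qed.

(** The two lower bounds for [mu] are tangents of [1 - (1 - s) ^ (19 / 25)], at 0
    and, up to rounding, at 1/2. The left factor [mu / s] increases while the right
    one decreases, so that finitely many intervals suffice; the constants in
    each are a lower bound for [mu / s], from its left end, and its right end. *)
Lemma gain_poly (s mu e : R) : 0 < s -> s <= 1 / 2 -> 0 <= e -> e <= 1011 / 1000 ->
  19 / 25 * s <= mu -> 897 / 1000 * s - 79 / 2000 <= mu ->
  e * s ^+ 4 <= mu ^+ 3 * (1 - (1 - s) ^+ 4).
Proof.
move=> s0 s1 e0 e1 m1 m2.
have mE : mu = mu / s * s by rewrite divfK ?gt_eqF.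
have ms : 0 <= mu / s * s.
  by rewrite -mE (le_trans _ m1) // mulr_ge0 ?divr_ge0 // ltW.
have cb (a b : R) : 0 <= a -> a * s <= mu -> s <= b -> b <= 1 / 2 ->
    1011 / 1000 <= a ^+ 3 * (4 - 6 * b + 4 * b ^+ 2 - b ^+ 3) ->
    e * s ^+ 4 <= mu ^+ 3 * (1 - (1 - s) ^+ 4).
  rewrite -ler_pdivlMr // => a0 ha sb b2 h; rewrite mE.
  exact: (cubic_bounds e0 a0 ms s0 ha sb b2 (le_trans e1 h)).
clear mE ms e0 e1.
have [h1|h1] := leP s (36 / 100).
  by apply: (cb (19 / 25) (36 / 100)); clear cb; lra.
clear m1; have [h2|h2] := leP s (42 / 100).
  by apply: (cb (787 / 1000) (42 / 100)); clear cb; lra.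
have [h3|h3] := leP s (46 / 100).
  by apply: (cb (802 / 1000) (46 / 100)); clear cb; lra.
have [h4|h4] := leP s (48 / 100).
  by apply: (cb (811 / 1000) (48 / 100)); clear cb; lra.
by apply: (cb (814 / 1000) (1 / 2)); clear cb; lra.
Qed.

(** This is where the exponential improvement comes from: with
    [mu = 1 - (1 - s) ^ (19 / 25)] the quantity [mu ^+ 3 * (1 - (1 - s) ^+ 4)], which
    bounds the cost of a blue vertex, beats the cost [s ^+ 4] of the binomial bound
    by the factor [expR (1 / 100)], the fourth power of the required one. *)
Lemma book_gain (s x : R) : 0 < s -> s <= 1 / 2 -> expR x = 1 - s ->
  expR (1 / 100) * s ^+ 4 <= (1 - expR (19 / 25 * x)) ^+ 3 * (1 - (1 - s) ^+ 4) /\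
  59 / 100 <= expR (19 / 25 * x).
Proof.
move=> s0 s1 xE; pose b : R := expR (- (19 / 25 * ln 2)).
have bE : b ^+ 25 = (1 / 2) ^+ 19.
  rewrite /b -expRM_natl; have -> : 25%:R * - (19 / 25 * ln 2) = 19%:R * - ln (2 : R).
    by field.
  by rewrite expRM_natl expRN lnK ?posrE // mul1r.
have /andP[b1 b2] := half_pow_bounds (b := b) (expR_ge0 _) bE.
have t01 : 0 <= (19 / 25 : R) <= 1 by clear; apply/andP; split; lra.
have x2E : expR (x + ln 2) = 2 * (1 - s) by rewrite expRD xE lnK ?posrE // mulrC.
(* The tangents at 0 and at 1/2, the latter from convexity at [2 * (1 - s)]. *)
have E1 := expR_convex x t01; rewrite xE in E1.
have E2 : expR (19 / 25 * x) <= b * (1 - 19 / 25 + 19 / 25 * (2 * (1 - s))).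
  have -> : 19 / 25 * x = - (19 / 25 * ln 2) + 19 / 25 * (x + ln 2) by ring.
  rewrite expRD ler_wpM2l ?expR_ge0 //.
  by have := expR_convex (x + ln 2) t01; rewrite x2E.
have E3 : b <= expR (19 / 25 * x).
  rewrite ler_expR -mulrN ler_pM2l ?divr_gt0 //.
  by rewrite -(ler_expR) xE expRN lnK ?posrE // -div1r; clear -s1; lra.
split; last exact: le_trans E3.
have e1 : expR (1 / 100) <= 1011 / 1000 :> R.
  by clear; apply: le_trans (expR_le _) _; first (apply/andP; split); lra.
apply: gain_poly => //; first exact: expR_ge0.
- by move: (expR (_ * x)) E1 => E E1; clear -E1; lra.
have {}E2 : expR (19 / 25 * x) <=
    5906 / 10000 * (1 - 19 / 25 + 19 / 25 * (2 * (1 - s))).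
  apply: (le_trans E2); rewrite ler_wpM2r //; clear -s0 s1; lra.
move: (expR (_ * x)) E2 => E E2; clear -E2 s0 s1; lra.
Qed.

(** For small [t] the left side is about
    [1 - t * (71 / 100 * E - 101 / 100 * (1 - E))], and the bracket is positive, though barely, at [E = 59 / 100]. *)
Lemma book_slack (E t : R) : 59 / 100 <= E -> 0 <= t -> t <= 1 / 300 ->
  E * expR (- (71 / 100 * t)) + (1 - E) * expR (101 / 100 * t) <= 1 - t / 1000.
Proof.
move=> hE t0 t1.
have hB : expR (101 / 100 * t) <= 1 + 101 / 100 * t + 2 * (101 / 100 * t) ^+ 2.
  by apply: expR_le; clear hE; apply/andP; split; lra.
have hR : expR (- (71 / 100 * t)) <= 1 - 71 / 100 * t + (71 / 100 * t) ^+ 2.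
  by apply: expRN_le; clear hE hB; lra.
have hRB : expR (- (71 / 100 * t)) <= expR (101 / 100 * t).
  by rewrite ler_expR; clear hE hB hR; lra.
move: (expR (101 / 100 * t)) (expR (- _)) hB hR hRB => sB sR hB hR hRB.
have h1 : 0 <= (E - 59 / 100) * (sB - sR) by rewrite mulr_ge0 ?subr_ge0.
have h2 : t ^+ 2 <= t / 300.
  by rewrite expr2 ler_wpM2l // -div1r.
clear -h1 h2 hB hR t0; lra.
Qed.

(** With [x = ln (1 - s)] and [t = - x / 300] all parameters are powers of [1 - s].
    A boost must leave [mu ^+ 3] intact, so [sB ^+ 300 = p^-1], where
    [p = (1 - s) ^ (101 / 100)] is slightly below [1 - s] to leave room for the
    loss in the degrees. A red move may cost [(1 - s) ^+ 4], of which [(1 - mu) ^+ 3]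
    takes the exponent [57 / 25] and [p] takes [101 / 100]; the remaining [71 / 100]
    go to [sR ^+ 300]. *)
Lemma book_parameters (s : R) : 0 < s -> s <= 1 / 2 ->
  exists p mu sR sB : R,
  [/\ [/\ 0 < p, p <= 1 - 251 / 250 * s, 0 <= mu <= 1, 0 < sR & sR <= sB],
      (1 - mu) * sR + mu * sB <= 1 - s / 1000 / 300,
      (1 - s) ^+ 4 <= ((1 - mu) * sR ^+ 100) ^+ 3 * p,
      mu ^+ 3 <= (mu * sB ^+ 100) ^+ 3 * p &
      expR (1 / 100) * s ^+ 4 <= mu ^+ 3 * (1 - (1 - s) ^+ 4)].
Proof.
move=> s0 s1.
have s2 : 0 < 1 - s by clear -s1; lra.
have [x xE] : exists x, expR x = 1 - s.
  by exists (ln (1 - s)); rewrite lnK ?posrE.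
have xs : x <= - s by have := expR_ge1Dx x; rewrite xE; clear; lra.
have x1 : - 1 <= x.
  have : expR (- x) <= 2.
    by rewrite expRN xE -div1r ler_pdivrMr //; clear -s1; lra.
  by have := expR_ge1Dx (- x); clear; lra.
have [gain E59] := book_gain s0 s1 xE.
have E1 : expR (19 / 25 * x) <= 1.
  by rewrite -[leRHS]expR0 ler_expR; clear -xs s0; lra.
pose t := - x / 300.
have t0 : s / 300 <= t by rewrite /t; clear -xs; lra.
have t0' : 0 <= t by clear -t0 s0; lra.
have t1 : t <= 1 / 300 by rewrite /t; clear -x1; lra.
exists (expR (101 / 100 * x)), (1 - expR (19 / 25 * x)),
  (expR (- (71 / 100 * t))), (expR (101 / 100 * t)).
rewrite subKr; split=> //.
- split; rewrite ?expR_gt0 //.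
  + have -> : 101 / 100 * x = x + x / 100 by clear; lra.
    rewrite expRD xE.
    have : expR (x / 100) * (1 - x / 100) <= 1.
      rewrite -[leRHS](expRxMexpNx_1 (x / 100)) ler_wpM2l ?expR_ge0 //.
      exact: expR_ge1Dx.
    have := expR_gt0 (x / 100); move: (expR _) => q q0 hq.
    have {}hq : q * (1 + s / 100) <= 1.
      apply: le_trans hq; rewrite ler_pM2l //; clear -xs; lra.
    have s3 : 0 < 1 + s / 100 by clear -s0; lra.
    have hs : (1 - s) * (q * (1 + s / 100)) <= 1 - s.
      by apply: ler_piMr => //; exact: ltW.
    rewrite mulrA in hs; rewrite -(ler_pM2r s3); apply: (le_trans hs).
    rewrite -subr_ge0.
    have -> : (1 - 251 / 250 * s) * (1 + s / 100) - (1 - s) =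
      s * (6 / 1000 - 251 / 250 / 100 * s) by field.
    by rewrite mulr_ge0 // ?(ltW s0) //; clear -s1; lra.
  + by rewrite subr_ge0 E1 /=; have := expR_ge0 (19 / 25 * x); clear; lra.
  + by rewrite ler_expR; clear -t0'; lra.
- apply: (le_trans (book_slack E59 t0' t1)); clear -t0; lra.
- rewrite -xE -!expRM_natl -!expRD -expRM_natl -expRD ler_expR /t.
  by rewrite le_eqVlt; apply/orP; left; apply/eqP; field.
- rewrite exprMn -[leRHS]mulrA ler_peMr ?exprn_ge0 ?subr_ge0 //.
  rewrite -!expRM_natl -expRD -[leLHS]expR0 ler_expR /t.
  by rewrite le_eqVlt; apply/orP; left; apply/eqP; field.
Qed.

End Exp.

(** * Binomial coefficients *)

Lemma binomial_term_le1 (R : realFieldType) (Z : R) j l : 0 <= Z <= 1 ->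
  'C(j + l, l)%:R * Z ^+ j * (1 - Z) ^+ l <= 1.
Proof.
move=> /andP[Z0 Z1]; have Z1' : 0 <= 1 - Z by rewrite subr_ge0.
have E := exprDn Z (1 - Z) (j + l); rewrite subrKC expr1n in E.
rewrite [leRHS]E.
have lj : (l < (j + l).+1)%N by rewrite ltnS leq_addl.
rewrite (bigD1 (Ordinal lj)) //= addnK -[X in _ <= X + _]mulr_natl mulrA lerDl.
by apply: sumr_ge0 => i _; rewrite mulrn_wge0 // mulr_ge0 ?exprn_ge0.
Qed.

(** In the expansion of [(k + l) ^ (k + l)] the term with index [l] is the largest:
    the quotient of consecutive terms passes 1 exactly there. *)
Lemma binomial_mode k l : (0 < k)%N ->
  ((k + l) ^ (k + l) <= (k + l).+1 * ('C(k + l, l) * (k ^ k * l ^ l)))%N.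
Proof.
move=> k0; set N := (k + l)%N.
pose f i := ('C(N, i) * (k ^ (N - i) * l ^ i))%N.
have step i : (i < N)%N -> (i.+1 * k * f i.+1 = (N - i) * l * f i)%N.
  move=> iN; rewrite /f.
  have -> : (N - i = (N - i.+1).+1)%N by lia.
  transitivity ((i.+1 * 'C(N, i.+1)) * (k ^ (N - i.+1).+1 * l ^ i.+1))%N.
    rewrite (expnS k); nia.
  rewrite mul_bin_left (expnS l) subnSK //; nia.
have up i : (i < l)%N -> (f i <= f i.+1)%N.
  move=> il; have iN : (i < N)%N by rewrite /N; lia.
  have c0 : (0 < i.+1 * k)%N by rewrite muln_gt0.
  rewrite -(leq_pmul2l c0) step // leq_mul2r; apply/orP; right.
  by rewrite mulnC leq_mul // /N; lia.
have down i : (l <= i)%N -> (i < N)%N -> (f i.+1 <= f i)%N.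
  move=> li iN; have c0 : (0 < i.+1 * k)%N by rewrite muln_gt0.
  rewrite -(leq_pmul2l c0) step // leq_mul2r; apply/orP; right.
  by rewrite [leqRHS]mulnC leq_mul // /N; lia.
have le_l i : (i <= N)%N -> (f i <= f l)%N.
  move=> iN; case: (leqP i l) => il.
    rewrite -(subKn il); elim: (l - i)%N (leq_subr i l) => [|d IH dl].
      by rewrite subn0.
    have dl' := ltnW dl; apply: leq_trans (IH dl').
    by rewrite -(subnSK dl); apply: up; rewrite ltn_subrL (leq_trans _ dl).
  rewrite -(subnKC (ltnW il)).
  have : (l + (i - l) <= N)%N by lia.
  elim: (i - l)%N => [|d IH dl]; first by rewrite addn0.
  apply: leq_trans (IH _); last by lia.
  by rewrite addnS; apply: down; lia.
rewrite -[X in (X <= _)%N]/((k + l) ^ N)%N expnDn -/N.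
have -> : ('C(N, l) * (k ^ k * l ^ l) = f l)%N by rewrite /f /N addnK.
apply: (@leq_trans (\sum_(i < N.+1) f l)).
  by apply: leq_sum => i _; apply: le_l; rewrite -ltnS.
by rewrite sum_nat_const card_ord.
Qed.

(** The binomial coefficient is [s ^- l * (1 - s) ^- k] up to a polynomial factor;
    this is the form in which the bound of the induction produces it. *)
Lemma binomial_mode_prob (R : realFieldType) k l (s : R) :
  (0 < k)%N -> s = l%:R / (k + l)%:R ->
  1 <= (k + l).+1%:R * 'C(k + l, l)%:R * (s ^+ l * (1 - s) ^+ k).
Proof.
move=> k0 sE; have N0 : 0 < (k + l)%:R :> R by rewrite ltr0n addn_gt0 k0.
have -> : 1 - s = k%:R / (k + l)%:R.
  by rewrite sE natrD; field; rewrite -natrD gt_eqF.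
rewrite {}sE.
have := binomial_mode l k0; rewrite -(ler_nat R) !natrM !natrX => h.
rewrite !expr_div_n mulf_div -exprD [(l + k)%N]addnC mulrA ler_pdivlMr ?exprn_gt0 //.
by rewrite mul1r (le_trans h) // le_eqVlt; apply/orP; left; apply/eqP; ring.
Qed.

Lemma exp2_le_bin k l : (l <= k)%N -> (2 ^ l <= 'C(k + l, l))%N.
Proof.
elim: l => [|l IH] lk; first by rewrite bin0.
rewrite -(leq_pmul2l (ltn0Sn l)) addnS -mul_bin_diag /=.
rewrite expnS mulnA leq_mul ?IH //; lia.
Qed.

(** * Colourings with large red degrees *)

Section Dense.
Variable R : realType.

(** The induction of [book_cliques] is started from [X = Y = setT]. All excesses are
    at least [f = (251 / 250 - 2007 / 2000) * s = s / 2000], so the initial weight is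
    at least [n * f ^+ 100], and the absence of cliques bounds
    [f ^+ 300 * (n * expR (l / 400) * (1 - s) ^+ k * s ^+ l) ^+ 4] by [K ^+ 3]. Both
    [f^-1] and [K] are at most [q], and [303 <= 4 * 76]. *)
Lemma dense_bound k l n (r : rel 'I_n) (s q : R) :
  1 <= q -> 1000 * 1000 <= q * s -> symmetric r ->
  (0 < l <= k)%N -> s = l%:R / (k + l)%:R ->
  ~ has_clique r true k setT -> ~ has_clique r false l setT ->
  (forall v, (1 - 2007 / 2000 * s) * n%:R <= #|nbr r true v|%:R) ->
  n%:R <= q ^+ 76 * (k + l).+1%:R *
          (expR (- (l%:R / 400)) * 'C(k + l, l)%:R).
Proof.
move=> q1 qs rC /andP[l0 lk] sE nored noblue deg.
have k0 : (0 < k)%N := leq_trans l0 lk.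
have kl0 : 0 < (k + l)%:R :> R by rewrite ltr0n addn_gt0 k0.
have s0 : 0 < s by rewrite sE divr_gt0 // ltr0n.
have [K [KE K0 Kq]] : exists K, [/\ K^-1 = s / 1000 / 300, 0 < K & K <= q].
  exists (s / 1000 / 300)^-1; rewrite invrK invr_gt0; split => //.
    by clear -s0; lra.
  rewrite -[leLHS]mul1r ler_pdivrMr; first by clear -qs; lra.
  by clear -s0; lra.
have [f [fE f0 fq]] : exists f, [/\ f = s / 2000, 0 < f & 1 <= f * q].
  by exists (s / 2000); split => //; [clear -s0|clear -qs]; lra.
clear qs; have q0 : 0 < q by apply: lt_le_trans q1.
have [n0|n0] := posnP n.
  rewrite n0; apply: mulr_ge0; last by rewrite mulr_ge0 ?expR_ge0.
  by rewrite mulr_ge0 ?exprn_ge0 ?ltW.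
have n0R : 0 < n%:R :> R by rewrite ltr0n.
have s1 : s <= 1 / 2.
  rewrite sE ler_pdivrMr // mulrC mul1r ler_pdivlMr // -natrM ler_nat.
  by rewrite muln2 -addnn leq_add2r.
have [p [mu [sR [sB [[p0 p1 mu01 sR0 sRB] hK redc boostc gain]]]]] :=
  book_parameters s0 s1.
have /andP[mu0 mu1] := mu01.
pose Z : R := (1 - s) ^+ 4.
have s2 : 0 < 1 - s by clear -s1; lra.
have Z0 : 0 < Z by rewrite exprn_gt0.
have Z1 : 0 < 1 - Z by rewrite subr_gt0 exprn_ilt1 // ?ltW //; clear -s0; lra.
pose D := K ^+ 3 / (1 - Z) ^+ l.
have D_ge j : K ^+ 3 * 'C(j + l, l)%:R * Z ^+ j <= D.
  rewrite /D ler_pdivlMr ?exprn_gt0 //.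
  have h : 'C(j + l, l)%:R * Z ^+ j * (1 - Z) ^+ l <= 1.
    by apply: binomial_term_le1; rewrite (ltW Z0) /= -subr_ge0 ltW.
  rewrite -(mulrA (K ^+ 3)) -mulrA; apply: ler_piMr h.
  by rewrite exprn_ge0 // ltW.
pose w := weight r p 99 [set: 'I_n] setT.
have small : w ^+ 3 * n%:R * Z ^+ k * (mu ^+ 3) ^+ l < D.
  rewrite ltNge; apply/negP => h.
  have := @book_cliques R _ r rC p mu sR sB K Z D 99 3 l isT p0 mu01 sR0 sRB K0.
  rewrite KE => /(_ hK Z0 redc boostc D_ge k l setT setT).
  rewrite setTU cardsT card_ord => /(_ h); case=> //.
have w_ge : n%:R * f ^+ 100 <= w.
  rewrite mulr_natl -[X in _ *+ X]card_ord -sumr_const /w /weight.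
  rewrite [leRHS](eq_bigl xpredT) => [|v]; last by rewrite inE.
  apply: ler_sum => v _; rewrite lerXn2r ?nnegrE ?(ltW f0) ?excess_ge0 //.
  rewrite /excess le_max; apply/orP; right; rewrite setTI cardsT card_ord.
  have : 1 - 2007 / 2000 * s <= #|nbr r true v|%:R / n%:R by rewrite ler_pdivlMr.
  by rewrite fE; move: (_ / n%:R) => d; clear -p1; lra.
pose g := (1 - s) ^+ k * s ^+ l.
have g0 : 0 < g by rewrite mulr_gt0 ?exprn_gt0.
pose N : R := n%:R * expR (l%:R / 400) * g.
have N0 : 0 <= N.
  by apply: mulr_ge0 (ltW g0); apply: mulr_ge0; rewrite ?expR_ge0.
have main : f ^+ 300 * N ^+ 4 <= K ^+ 3.
  have h1 : w ^+ 3 * n%:R * Z ^+ k * (mu ^+ 3 * (1 - Z)) ^+ l <= K ^+ 3.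
    rewrite [(mu ^+ 3 * _) ^+ l]exprMn mulrA -ler_pdivlMr; first exact: ltW small.
    exact: exprn_gt0.
  apply: le_trans h1.
  have -> : f ^+ 300 * N ^+ 4 =
     (n%:R * f ^+ 100) ^+ 3 * n%:R * Z ^+ k * (expR (1 / 100) * s ^+ 4) ^+ l.
    have eE : expR (1 / 100) ^+ l = expR (l%:R / 400) ^+ 4 :> R.
      by rewrite -!expRM_natl; congr expR; field.
    rewrite /N /g /Z (exprMn l) eE (exprAC (1 - s)) (exprAC s).
    by move: (expR _) ((1 - s) ^+ k) (s ^+ l) => e a b; clear; ring.
  have nf0 : 0 <= n%:R * f ^+ 100 by rewrite mulr_ge0 ?exprn_ge0 ?(ltW f0).
  have es0 : 0 <= expR (1 / 100) * s ^+ 4.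
    by rewrite mulr_ge0 ?expR_ge0 ?exprn_ge0 ?(ltW s0).
  have Zk0 : 0 <= Z ^+ k := exprn_ge0 k (ltW Z0).
  apply: ler_pM.
  - apply: mulr_ge0 Zk0; apply: mulr_ge0 (ler0n _ _); exact: exprn_ge0.
  - exact: exprn_ge0.
  - apply: ler_wpM2r => //; apply: ler_wpM2r => //.
    by rewrite lerXn2r ?nnegrE // weight_ge0.
  - by rewrite lerXn2r ?nnegrE // (le_trans es0).
have q300 : 0 <= q ^+ 300 := exprn_ge0 300 (ltW q0).
have Nq : N <= q ^+ 76.
  have h1 : N ^+ 4 <= q ^+ 300 * (f ^+ 300 * N ^+ 4).
    rewrite mulrA -exprMn ler_peMl //; first exact: exprn_ge0.
    by rewrite exprn_ege1 // mulrC.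
  have h2 : q ^+ 300 * K ^+ 3 <= q ^+ 300 * q ^+ 3.
    by apply: ler_wpM2l => //; rewrite lerXn2r ?nnegrE ?(ltW K0) ?(ltW q0).
  have h3 : N ^+ 4 <= (q ^+ 76) ^+ 4.
    apply: (le_trans h1); apply: (le_trans (ler_wpM2l q300 main)).
    by apply: (le_trans h2); rewrite -exprD -exprM ler_weXn2l.
  by rewrite -(@ler_pXn2r _ 4) ?nnegrE // exprn_ge0 // ltW.
have mode := binomial_mode_prob k0 sE.
have e0 := expR_gt0 (l%:R / 400 : R).
apply: (@le_trans _ _ (n%:R * ((k + l).+1%:R * 'C(k + l, l)%:R * g))).
  by rewrite ler_peMr // /g [_ ^+ k * _]mulrC.
have -> : n%:R * ((k + l).+1%:R * 'C(k + l, l)%:R * g) =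
   N * (k + l).+1%:R * (expR (- (l%:R / 400)) * 'C(k + l, l)%:R).
  rewrite /N expRN; field; exact: lt0r_neq0.
by rewrite ler_wpM2r ?ler_wpM2r ?mulr_ge0 ?expR_ge0.
Qed.

End Dense.

(** * The bound for a fixed error *)

Section Asymptotic.
Variable R : realType.
Implicit Types e A : R.

Lemma linear_le_expR e A : 0 < e -> 0 <= A ->
  exists K0, forall k, (K0 <= k)%N -> A * k%:R <= expR (e * k%:R).
Proof.
move=> e0 A0; pose B := 2 * A / e ^+ 2.
have B0 : 0 <= B by rewrite /B !mulr_ge0 ?invr_ge0 ?exprn_ge0 // ltW.
exists (Num.bound B) => k hk.
have kB : B <= k%:R by rewrite (le_trans (ltW (archi_boundP B0))) // ler_nat.
have ek : 0 <= e * k%:R by rewrite mulr_ge0 // ltW.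
have h : 1 + (e * k%:R) ^+ 2 / 2 <= expR (e * k%:R) := expR_ge1Dxn 1 ek.
have : A * k%:R <= (e * k%:R) ^+ 2 / 2.
  have -> : (e * k%:R) ^+ 2 / 2 = (e ^+ 2 / 2 * k%:R) * k%:R by field.
  apply: ler_wpM2r => //; have -> : A = e ^+ 2 / 2 * B.
    by rewrite /B; field; rewrite gt_eqF.
  by apply: ler_wpM2l => //; rewrite divr_ge0 ?exprn_ge0 // ltW.
by move: (A * _) (_ ^+ 2 / _) h => a b; clear; lra.
Qed.

Lemma ramsey_large k l (T : R) : T < (ramsey k l)%:R -> 0 <= T ->
  exists n (r : rel 'I_n), [/\ T < n.+1%:R, symmetric r,
    ~ has_clique r true k setT & ~ has_clique r false l setT].
Proof.
case En : (ramsey k l) => [|n] hT T0; first by move: hT; rewrite ltNge T0.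
have [|r [rC h1 h2]] := @ramsey_colouring n k l; first by rewrite En.
by exists n, r.
Qed.

(** A blue neighbourhood of [ramsey k l] vertices would contain a red [k]-clique, or
    a blue [l]-clique that the vertex itself extends. *)
Lemma red_degree_ge k l n (r : rel 'I_n) (v : 'I_n) : symmetric r ->
  ~ has_clique r true k setT -> ~ has_clique r false l.+1 setT ->
  (n <= #|nbr r true v| + ramsey k l)%N.
Proof.
move=> rC h1 h2; have := card_nbr r (in_setT v); rewrite !setTI cardsT card_ord => E.
rewrite [leqLHS]E -addnS leq_add2l ltnNge; apply/negP => /(ramsey_clique rC)[h|h].
  by apply: h1; apply: has_clique_sub h; exact: subsetT.
by apply: h2; apply: (has_clique_nbr rC (in_setT v)); rewrite setTI.
Qed.

(** Induction on [l] for fixed [k]. When [l / 400 <= e * k] the binomial bound is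
    already good enough. Otherwise [s = l / (k + l)] is bounded below, and the bound
    for [l.-1] limits the blue degrees of a counterexample: passing from [l] to
    [l.-1] multiplies the bound by [expR (1 / 400) * s], hence the blue degrees are
    at most about [1003 / 1000 * s * n], which leaves red degrees that meet the
    hypothesis of [dense_bound]. The polynomial factors that it loses, and the
    constant depending on [e], are absorbed by [expR (e * k)]. *)
Lemma ramsey_le_expR e : 0 < e -> e <= 1 ->
  exists K0, forall k, (K0 <= k)%N -> forall l, (l <= k)%N ->
    (ramsey k l)%:R <= expR (- (l%:R / 400) + e * k%:R) * 'C(k + l, l)%:R.
Proof.
move=> e0 e1.
have [q [q1 hq]] : exists q : R, 1 <= q /\
    forall s, e <= s -> 1000 * 1000 <= q * s.
  exists (1000 * (1000 * (1 / e))).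
  have h : 1 <= 1 / e by rewrite ler_pdivlMr // mul1r.
  split; first by clear -h; lra.
  move=> s hs; have : 1 <= 1 / e * s by rewrite mulrAC mul1r ler_pdivlMr // mul1r.
  by clear; lra.
have Q1 : 1 <= q ^+ 76 by rewrite exprn_ege1.
have A0 : 0 <= 4 * q ^+ 76 + 3000 by clear -Q1; lra.
have [K0 hK0] := linear_le_expR e0 A0.
clear A0.
exists K0.+1 => k kK l; have k0 : (0 < k)%N by apply: leq_trans kK.
have {}hK0 := hK0 _ (ltnW kK).
have k1 : 1 <= k%:R :> R by rewrite ler1n.
have Qk : q ^+ 76 * (2 * k%:R + 2) <= expR (e * k%:R).
  apply: le_trans hK0; move: (q ^+ 76) Q1 => Q Q1.
  have h : 0 <= (k%:R - 1) * (2 * Q) by rewrite mulr_ge0 ?subr_ge0 //; clear -Q1; lra.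
  clear -h k1; lra.
(* Makes [n] so large that the rounding of [n.+1] to [n] is harmless. *)
have ek3000 : 3000 <= expR (e * k%:R).
  apply: le_trans hK0; move: (q ^+ 76) Q1 => Q Q1.
  have h : 0 <= (k%:R - 1) * (4 * Q + 3000).
    by rewrite mulr_ge0 ?subr_ge0 //; clear -Q1; lra.
  clear -h Q1; lra.
clear hK0 K0 kK; elim: l => [|l IH] lk.
  apply: (@le_trans _ _ 'C(k + 0, 0)%:R); first by rewrite ler_nat ramsey_le_bin.
  by rewrite ler_peMl // mul0r oppr0 add0r -[leLHS]expR0 ler_expR mulr_ge0 // ltW.
have {}IH := IH (ltnW lk).
have [le_ek|lt_ek] := leP (l.+1%:R / 400) (e * k%:R).
  apply: (@le_trans _ _ 'C(k + l.+1, l.+1)%:R); first by rewrite ler_nat ramsey_le_bin.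
  by rewrite ler_peMl // -[leLHS]expR0 ler_expR addrC subr_ge0.
set C : R := 'C(k + l.+1, l.+1)%:R; pose t := expR (- (l.+1%:R / 400)) * C.
have TE : expR (- (l.+1%:R / 400) + e * k%:R) * C = expR (e * k%:R) * t.
  by rewrite expRD /t mulrAC mulrC.
have t1 : 1 <= t.
  rewrite /t expRN mulrC ler_pdivlMr ?expR_gt0 // mul1r.
  apply: (@le_trans _ _ (2 ^+ l.+1)); last by rewrite -natrX ler_nat exp2_le_bin.
  rewrite (_ : l.+1%:R / 400 = l.+1%:R * (1 / 400)); last by field.
  rewrite expRM_natl lerXn2r ?nnegrE ?expR_ge0 //.
  by apply: le_trans (expR_le _) _; clear; [apply/andP; split|]; lra.
rewrite TE leNgt; apply/negP => /ramsey_large[|n [r [Tn rC h1 h2]]].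
  by rewrite mulr_ge0 ?expR_ge0 // (le_trans ler01).
set s : R := l.+1%:R / (k + l.+1)%:R.
have kl0 : 0 < (k + l.+1)%:R :> R by rewrite ltr0n addnS.
have s0 : 0 < s by rewrite divr_gt0 // ltr0n.
have es : e <= s.
  rewrite /s ler_pdivlMr //.
  have h : (k + l.+1)%:R <= 2 * k%:R :> R.
    by rewrite -natrM ler_nat mul2n -addnn leq_add2l.
  have := ler_wpM2l (ltW e0) h; move: lt_ek (ler0n R l.+1).
  by move: ((k + l.+1)%:R : R) (l.+1%:R : R) (k%:R : R) => a b c; clear; lra.
have n3000 : 3000 < n.+1%:R :> R.
  apply: le_lt_trans Tn; apply: (le_trans ek3000).
  by rewrite ler_peMr // expR_ge0.
have Tl : (ramsey k l)%:R <= 1003 / 1000 * s * n.+1%:R.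
  apply: (le_trans IH).
  have -> : expR (- (l%:R / 400) + e * k%:R) * 'C(k + l, l)%:R =
      expR (1 / 400) * s * (expR (e * k%:R) * t).
    have bE : 'C(k + l, l)%:R = s * C.
      rewrite /s /C mulrAC -natrM -mul_bin_diag addnS /= natrM mulrC mulKf //.
      by rewrite gt_eqF // ltr0n.
    rewrite bE /t (_ : - (l%:R / 400) = 1 / 400 - l.+1%:R / 400).
      by rewrite !expRD; ring.
    by rewrite -natr1; field.
  apply: ler_pM.
  - by apply: mulr_ge0 (expR_ge0 _) (ltW s0).
  - by apply: mulr_ge0 (expR_ge0 _) (le_trans ler01 t1).
  - apply: (ler_wpM2r (ltW s0)).
    by apply: le_trans (expR_le _) _; clear; [apply/andP; split|]; lra.
  - exact: ltW.
have deg v : (1 - 2007 / 2000 * s) * n%:R <= #|nbr r true v|%:R.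
  have := red_degree_ge v rC h1 h2; rewrite -(ler_nat R) natrD.
  have : 1003 / 1000 * s * n.+1%:R <= 2007 / 2000 * s * n%:R.
    rewrite mulrAC [leRHS]mulrAC ler_wpM2r ?(ltW s0) // -natr1.
    by rewrite -natr1 in n3000; clear -n3000; lra.
  move: Tl; move: (s * n%:R) (_ * n.+1%:R) (ramsey k l)%:R (#|_|%:R) => a b c d.
  clear; lra.
have lk' : (0 < l.+1 <= k)%N by [].
have := dense_bound q1 (hq _ es) rC lk' (erefl s) h1 h2 deg.
rewrite -/C -/t => nt; move: Tn; rewrite ltNge => /negP; apply.
apply: le_trans (ler_wpM2r (le_trans ler01 t1) Qk).
have kl : (k + l.+1).+1%:R <= 2 * k%:R + 1 :> R.
  by rewrite -natrM natr1 ler_nat ltnS mul2n -addnn leq_add2l.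
have Q0 : 0 <= q ^+ 76 := le_trans ler01 Q1.
have {}nt : n%:R <= q ^+ 76 * (2 * k%:R + 1) * t.
  apply: (le_trans nt); apply: ler_wpM2r; first exact: le_trans t1.
  exact: ler_wpM2l.
have Qt : 1 <= q ^+ 76 * t by rewrite mulr_ege1.
rewrite -natr1 (_ : 2 * k%:R + 2 = 2 * k%:R + 1 + 1 :> R); last by ring.
by rewrite mulrDr mulrDl mulr1 lerD.
Qed.

End Asymptotic.

(** * A uniform error term *)

From mathcomp Require Import all_classical all_reals all_analysis.
Import numFieldNormedType.Exports.
Local Open Scope classical_set_scope.
Local Open Scope ring_scope.

Theorem theorem14p1 (R : realType) :
  exists o : nat -> R,
    (o k / k%:R @[k --> \oo] --> (0 : R)) /\
    forall k l : nat, (l <= k)%N ->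
      (ramsey k l)%:R <= expR (- (l%:R / 400) + o k) * ('C(k + l, l))%:R.
Proof.
pose B (k l : nat) : R := expR (- (l%:R / 400)) * ('C(k + l, l))%:R.
have B0 k l : 0 < B k l.
  by rewrite mulr_gt0 ?expR_gt0 // ltr0n bin_gt0 leq_addl.
(* The largest logarithmic loss over all admissible [l]. *)
pose o (k : nat) : R :=
  \big[Num.max/0]_(l < k.+1) ln ((ramsey k l)%:R / B k l).
exists o; split; last first.
  move=> k l lk; rewrite addrC expRD -mulrA -/(B k l).
  have [R0|R0] := posnP (ramsey k l).
    by rewrite R0 mulr_ge0 ?expR_ge0 // ltW.
  have RB : 0 < (ramsey k l)%:R / B k l by rewrite divr_gt0 // ltr0n.
  rewrite -ler_pdivrMr // -[leLHS]lnK ?posrE // ler_expR.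
  have lk' : (l < k.+1)%N by [].
  exact: (le_bigmax 0 (fun i : 'I_k.+1 => ln ((ramsey k i)%:R / B k i))
            (Ordinal lk')).
have o0 k : 0 <= o k by exact: bigmax_ge_id.
apply/cvgrPdist_le => e e0.
have m0 : 0 < Num.min e 1 by rewrite lt_min e0 ltr01.
have m1 : Num.min e 1 <= 1 by rewrite ge_min lexx orbT.
have [K0 hK] := ramsey_le_expR m0 m1.
exists K0.+1 => // k /= kK.
have k0 : 0 < k%:R :> R by rewrite ltr0n (leq_trans _ kK).
rewrite sub0r normrN ger0_norm ?divr_ge0 ?(ltW k0) //.
rewrite ler_pdivrMr //; apply: (@le_trans _ _ (Num.min e 1 * k%:R)); last first.
  by rewrite ler_wpM2r ?(ltW k0) // ge_min lexx.
apply: bigmax_le => [|l _]; first by rewrite mulr_ge0 // ltW.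
have [R0|R0] := posnP (ramsey k l).
  by rewrite R0 mul0r ln0 // mulr_ge0 // ltW.
have RB : 0 < (ramsey k l)%:R / B k l by rewrite divr_gt0 // ltr0n.
rewrite -ler_expR lnK ?posrE // ler_pdivrMr //.
have := hK k (ltnW kK) l (ltn_ord l : (l <= k)%N).
by rewrite addrC expRD -mulrA.
Qed.
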